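(* If $X$ is a $\sigma$-compact, nowhere locally compact, metrizable space, then $\varrho(X)$ is homeomorphic to $\varrho(\mathbb{Q})$.
   Context: For a Tychonoff space $X$, $\beta X$ is its Čech–Stone compactification and $X^\ast=\beta X\setminus X$. A point $p\in X^\ast$ is a remote point of $X$ if $p\notin \mathrm{cl}_{\beta X}(A)$ for every nowhere dense subset $A$ of $X$. $\varrho(X)$ denotes the set of remote points of $X$, with the subspace topology from $\beta X$. A space is nowhere locally compact if none of its points has a compact neighborhood. $\mathbb{Q}$ is the space of rational numbers with its usual topology. *)

(* Defs.v *)
From mathcomp Require Import all_boot all_order all_algebra.
From mathcomp Require Import all_classical reals topology.

Set Implicit Arguments.
Unset Strict Implicit.
Unset Printing Implicit Defensive.

Import Order.TTheory GRing.Theory Num.Theory.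
Import numFieldTopology.Exports.

Local Open Scope classical_set_scope.
Local Open Scope ring_scope.

Definition metrizable (R : realType) (X : topologicalType) : Prop :=
  exists d : X -> X -> R,
    [/\ forall x y, d x y = 0 <-> x = y,
        forall x y, d x y = d y x,
        forall x y z, d x z <= d x y + d y z
      & forall x (A : set X),
          nbhs x A <-> exists2 e : R, 0 < e & [set y | d x y < e] `<=` A].

Definition sigma_compact (X : topologicalType) : Prop :=
  exists2 K : nat -> set X,
    forall n, compact (K n) & \bigcup_n K n = [set: X].

Definition nowhere_locally_compact (X : topologicalType) : Prop :=
  forall x : X, ~ exists2 K : set X, nbhs x K & compact K.

Definition nowhere_dense (X : topologicalType) (A : set X) : Prop :=
  (closure A)° = set0.

Definition homeomorphic (S T : topologicalType) : Prop :=
  exists (f : S -> T) (g : T -> S),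
    [/\ cancel f g, cancel g f, continuous f & continuous g].

(* [R^o] carries the topology of the distance [|x - y|], for any numFieldType
   [R]; [rat] by itself has no declared topology. *)
Definition rationals : topologicalType := rat^o.

Section StoneCech.
Context (R : realType) (X : topologicalType).

Definition unit_function : Type :=
  set_type [set f : X -> R | continuous f /\ forall x, 0 <= f x <= 1].

Definition cube_point (x : X) : prod_topology (fun _ : unit_function => R) :=
  fun f => \val f x.

(* The Čech–Stone compactification: the closure of the image of X in the cube
   [0, 1]^C(X, [0, 1]).  The product of copies of R is used in place of the
   cube, which is closed in it, so that the closure is the same. *)
Definition stone_cech : topologicalType :=
  set_type (closure (range cube_point)).

Definition to_stone_cech (x : X) : stone_cech :=
  SigSub (mem_set (subset_closure (imageT cube_point x))).

Definition stone_cech_remainder : set stone_cech := ~` range to_stone_cech.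

Definition remote_points : set stone_cech :=
  [set p | stone_cech_remainder p /\
     forall A : set X, nowhere_dense A -> ~ closure (to_stone_cech @` A) p].

End StoneCech.

Arguments stone_cech R X : clear implicits.
Arguments stone_cech_remainder R X : clear implicits.
Arguments remote_points R X : clear implicits.

(* Main.v *)
(* Any two nonempty sigma-compact, nowhere locally compact, metrizable spaces
   [X] and [Y] have homeomorphic spaces of remote points.  Each of them carries
   a tree of open sets [W s] with nonempty compact pieces [F s], indexed by the
   same tree of finite sequences of naturals: [F s] contains the trace of the
   [n]-th compact set on the closure of [W s], where [n] is the length of [s],
   and the children of [W s] form layers around [F s], shrinking to it.  Relate
   [x] and [y] when they lie in pieces with a common index.  This relation plays
   the role of a perfect irreducible map: images of closed sets are closed, and
   every nonempty open set contains the full preimage of one, in both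
   directions.  Hence it preserves nowhere dense closed sets, and it transports
   the filter of closed sets adherent to a remote point of [X] to a filter which
   determines one remote point of [Y]. *)

Require Import Defs.
From mathcomp Require Import all_boot all_order all_algebra.
From mathcomp Require Import all_classical reals topology normedtype.
From mathcomp Require Import ring lra.

Set Implicit Arguments.
Unset Strict Implicit.
Unset Printing Implicit Defensive.
Import Order.TTheory GRing.Theory Num.Theory.
Import numFieldTopology.Exports numFieldNormedType.Exports.
Local Open Scope classical_set_scope.
Local Open Scope ring_scope.

(** * The Čech–Stone compactification *)

Section Beta.
Context (R : realType) (X : topologicalType).
Notation beta := (stone_cech R X).
Notation emb := (@to_stone_cech R X).

Definition beta_closure (A : set X) : set beta := closure (emb @` A).

Lemma beta_closureS (A B : set X) :
  A `<=` B -> beta_closure A `<=` beta_closure B.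
Proof. by move=> AB; apply/closureS/image_subset. Qed.

Lemma beta_closureU (A B : set X) :
  beta_closure (A `|` B) = beta_closure A `|` beta_closure B.
Proof. by rewrite /beta_closure image_setU closureU. Qed.

Lemma beta_closure_self (A : set X) x : A x -> beta_closure A (emb x).
Proof. by move=> Ax; apply: subset_closure; exists x. Qed.

Lemma eval_continuous (f : unit_function R X) :
  continuous ((fun p => \val p f) : beta -> R).
Proof.
move=> p.
have c1 : {for p, continuous (set_val : beta -> prod_topology (fun=> R))}.
  exact: initial_continuous.
apply: (@continuous_comp _ _ _ (set_val : beta -> _) (fun g => g f) p) => //.
exact: (@proj_continuous {classic (unit_function R X)} (fun=> R) f).
Qed.

Lemma cube_point_continuous :
  continuous (@cube_point R X : X -> prod_topology (fun=> R)).
Proof.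
move=> x; apply/cvg_sup => f U [V] [[W] oW <-] Wx WU.
have [cf _] := set_mem (valP f).
have : nbhs x (\val f @^-1` W) by apply: cf; exact: open_nbhs_nbhs.
by apply: filterS => y Wy; apply: WU.
Qed.

Lemma to_stone_cech_continuous : continuous emb.
Proof. by apply: continuous_comp_initial; exact: cube_point_continuous. Qed.

Lemma beta_hausdorff : hausdorff_space beta.
Proof.
move=> p q pq; apply: val_inj; apply: functional_extensionality_dep => f.
apply: (@Rhausdorff R) => A B nA nB.
have := pq _ _ (@eval_continuous f p _ nA) (@eval_continuous f q _ nB).
by case=> r [Ar Br]; exists (\val r f).
Qed.

Lemma beta_regular : regular_space beta.
Proof. exact: uniform_regular. Qed.

(** The image of [X] is dense in [beta]; thus open sets of [beta] can be handled through their
    traces on [X]. *)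
Lemma beta_dense (O : set beta) : open O -> O `<=` beta_closure (emb @^-1` O).
Proof.
move=> oO p Op B nB.
have /= := filterI (open_nbhs_nbhs (conj oO Op)) nB.
move=> [V [[W oW <-]] /= Wp WOB].
have [_ [[x _ <-]] Wx] :=
  set_mem (valP p) _ (open_nbhs_nbhs (conj oW Wp)).
have [Ox Bx] := WOB (emb x) Wx.
by exists (emb x); split => //; exists x.
Qed.

(** Compactness in terms of subsets of [X]: the images of the members of [S] generate a filter
    containing the cube, and Tychonoff's theorem gives a cluster point, which lies in the closure of
    the image of [X]. *)
Lemma beta_compact (S : set (set X)) :
  S !=set0 -> (forall A, S A -> A !=set0) ->
  (forall A B, S A -> S B -> S (A `&` B)) ->
  exists q, forall A, S A -> beta_closure A q.
Proof.
move=> S0 Sne SI.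
pose F := filter_from S (fun A => (@cube_point R X) @` A).
have FF : Filter F.
  apply: filter_from_filter => // A B SA SB; exists (A `&` B); first exact: SI.
  by move=> _ [x [Ax Bx] <-]; split; exists x.
have PF : ProperFilter F.
  by apply: filter_from_proper => A /Sne [x Ax]; exists (cube_point x); exists x.
have c01 (f : {classic unit_function R X}) : compact (`[0, 1]%classic : set R).
  exact: segment_compact.
have [|q [_ Fq]] := tychonoff c01 PF.
  have [A SA] := S0; exists A => // _ [x _ <-] f /=.
  by have [_ /(_ x)] := set_mem (valP f); rewrite in_itv.
have qcl : closure (range (@cube_point R X)) q.
  move=> B nB; have [A SA] := S0.
  have [|_ [[x _ <-] Bx]] := Fq (@cube_point R X @` A) B _ nB.
    by exists A.
  by exists (cube_point x); split => //; exists x.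
exists (SigSub (mem_set qcl)) => A SA B [V [[W oW <-]] /= Wq WB].
have [||_ [[x Ax <-] Wx]] := Fq (@cube_point R X @` A) W.
- by exists A.
- exact: open_nbhs_nbhs.
by exists (emb x); split; [exists x | apply: WB].
Qed.

(** By regularity some neighbourhood [V] of [p] has its closure inside [O]; [B] is what remains of
    [X] without the trace of the interior of [V]. So closures of closed subsets of [X] form a base
    of closed sets. *)
Lemma beta_closed_base (O : set beta) p : open O -> O p ->
  exists B, [/\ closed B, ~ beta_closure B p &
    forall q, ~ O q -> beta_closure B q].
Proof.
move=> oO Op.
have [V /= nV VO] := beta_regular (open_nbhs_nbhs (conj oO Op)).
exists (~` (emb @^-1` V°)); split.
- apply: open_closedC; apply: open_comp; last exact: open_interior.
  by move=> x _; exact: to_stone_cech_continuous.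
- move=> /(_ V°) [|_ [[x nVx <-] //]].
  by apply: open_nbhs_nbhs; split; [exact: open_interior|].
- move=> q nOq; have : (~` closure V) q by move=> /VO.
  move=> /(beta_dense (closed_openC (@closed_closure _ V))).
  apply: beta_closureS => x nVx Vx; apply: nVx; apply: subset_closure.
  exact: interior_subset Vx.
Qed.

Lemma beta_neq p q : p <> q ->
  exists B, [/\ closed B, ~ beta_closure B p & beta_closure B q].
Proof.
move=> pq; have [||B [cB nBp Bq]] := @beta_closed_base (~` [set q]) p.
- apply: closed_openC; exact: (accessible_closed_set1 (hausdorff_accessible beta_hausdorff)).
- by [].
by exists B; split => //; apply: Bq; apply.
Qed.

Lemma open_boundary_nowhere_dense (V : set X) :
  open V -> nowhere_dense (closure V `&` ~` V).
Proof.
move=> oV; rewrite /nowhere_dense -(closure_id _).1; last first.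
  by apply: closedI; [exact: closed_closure | exact: open_closedC].
apply/seteqP; split => // x nx.
have [Vx _] := interior_subset nx.
by have [y [Vy [_]]] := Vx _ nx.
Qed.

(** The cut runs along the boundary of the trace on [X] of the complement of [beta_closure B]. Such
    a boundary is nowhere dense, so remote points do not adhere to it. *)
Lemma beta_closure_split (B : set X) p : ~ beta_closure B p ->
  exists C D, [/\ closed C, closed D, C `|` D = setT, nowhere_dense (C `&` D)
    & B `<=` C /\ ~ beta_closure C p].
Proof.
move=> nBp; have oO : open (~` beta_closure B).
  by apply: closed_openC; exact: closed_closure.
have oV : open (emb @^-1` (~` beta_closure B)).
  by apply: open_comp => // x _; exact: to_stone_cech_continuous.
exists (~` (emb @^-1` (~` beta_closure B))), (closure (emb @^-1` (~` beta_closure B))).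
split.
- exact: open_closedC.
- exact: closed_closure.
- apply/seteqP; split => // x _.
  by have [Vx|] := pselect ((emb @^-1` (~` beta_closure B)) x);
    [right; exact: subset_closure|left].
- by rewrite setIC; exact: open_boundary_nowhere_dense.
split; first by move=> x Bx; apply; exact: beta_closure_self.
move=> /(_ (~` beta_closure B)) [|_ [[x nVx <-] //]].
exact: open_nbhs_nbhs.
Qed.

Lemma beta_closureT p : beta_closure setT p.
Proof. by have := beta_dense openT (I : setT p); rewrite preimage_setT. Qed.

Lemma beta_closure_neq0 A p : beta_closure A p -> A !=set0.
Proof. by move=> /(_ setT filterT) [_ [[x Ax _] _]]; exists x. Qed.

(** [G] is the trace of a closed neighbourhood of [p] disjoint from [beta_closure A]. *)
Lemma beta_closure_separate (A : set X) p : ~ beta_closure A p ->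
  exists G, [/\ closed G, A `&` G = set0
    & forall C, beta_closure C p -> beta_closure (C `&` G) p].
Proof.
move=> nAp; have oO : open (~` beta_closure A).
  by apply: closed_openC; exact: closed_closure.
have [V /= nV VO] := beta_regular (open_nbhs_nbhs (conj oO nAp)).
exists (emb @^-1` closure V); split.
- apply: closed_comp; last exact: closed_closure.
  by move=> x _; exact: to_stone_cech_continuous.
- apply/seteqP; split => // x [Ax /VO]; apply; exact: beta_closure_self.
- move=> C Cp U nU; have [_ [[x Cx <-] [Ux Vx]]] := Cp _ (filterI nU nV).
  by exists (emb x); split => //; exists x => //; split => //; exact: subset_closure.
Qed.

(** Normality, phrased with functions that are themselves coordinates of the cube. *)
Definition has_urysohn : Prop :=
  forall A B : set X, closed A -> closed B ->
  A `&` B = set0 -> exists f : X -> R,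
    [/\ continuous f, forall x, 0 <= f x <= 1, forall x, A x -> f x = 0
      & forall x, B x -> f x = 1].

Hypothesis urysohn : has_urysohn.

(** The Urysohn function is a coordinate of the cube, equal to 0 on one closure and to 1 on the
    other. *)
Lemma beta_closure_disjoint (A B : set X) p : closed A -> closed B ->
  A `&` B = set0 -> beta_closure A p -> ~ beta_closure B p.
Proof.
move=> cA cB AB0 Ap Bp; have [f [cf f01 f0 f1]] := urysohn cA cB AB0.
pose g : unit_function R X := SigSub (mem_set (conj cf f01)).
have cl1 (c : R) : closed ((fun q : beta => \val q g) @^-1` [set c]).
  apply: closed_comp; first by move=> q _; exact: eval_continuous.
  exact: (accessible_closed_set1 (hausdorff_accessible (@Rhausdorff R))).
have sub (C : set X) (c : R) : (forall x, C x -> f x = c) ->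
    beta_closure C p -> \val p g = c.
  move=> fC Cp; suff: ((fun q : beta => \val q g) @^-1` [set c]) p by [].
  rewrite ((closure_id _).1 (cl1 c)).
  by move: Cp; apply: closureS => _ [x Cx <-]; exact: fC.
by move: (sub _ _ f0 Ap); rewrite (sub _ _ f1 Bp) => /eqP; rewrite oner_eq0.
Qed.

(** Otherwise, cutting both sets down to the trace [G] of a neighbourhood of [p] gives disjoint
    closed sets whose closures both contain [p]. *)
Lemma beta_closureI (A B : set X) p : closed A -> closed B ->
  beta_closure A p -> beta_closure B p -> beta_closure (A `&` B) p.
Proof.
move=> cA cB Ap Bp; apply: contrapT => /beta_closure_separate[G [cG ABG0 tG]].
apply: (beta_closure_disjoint _ _ _ (tG _ Ap) (tG _ Bp)).
- exact: closedI.
- exact: closedI.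
- by rewrite setIACA setIid.
Qed.

Lemma beta_closure_meets (A B : set X) p : closed A -> closed B ->
  beta_closure A p -> beta_closure B p -> A `&` B !=set0.
Proof.
move=> cA cB Ap Bp; apply/set0P/eqP => AB0.
exact: beta_closure_disjoint AB0 Ap Bp.
Qed.

End Beta.

Arguments has_urysohn R X : clear implicits.

(** * Irreducible relations *)

Lemma closed_nowhere_dense (X : topologicalType) (A : set X) : closed A ->
  nowhere_dense A <-> forall U, open U -> U !=set0 -> U `\` A !=set0.
Proof.
move=> cA; rewrite /nowhere_dense -((closure_id _).1 cA); split.
  move=> A0 U oU [x Ux]; apply: contrapT => nUA.
  suff : A° x by rewrite A0.
  apply: (@filterS _ _ _ U); last exact: open_nbhs_nbhs.
  by move=> y Uy; apply: contrapT => nAy; apply: nUA; exists y.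
move=> h; apply: contrapT => /eqP/set0P nA.
by have [y [/interior_subset]] := h _ (@open_interior _ A) nA.
Qed.

Definition rel_image (X Y : Type) (T : X -> Y -> Prop) (A : set X) : set Y :=
  [set y | exists2 x, A x & T x y].

Definition converse (X Y : Type) (T : X -> Y -> Prop) : Y -> X -> Prop :=
  fun y x => T x y.

(* For the graph of a map [X -> Y], this together with the same property of the
   converse says that the map is a closed irreducible surjection. *)
Record irreducible_rel (X Y : topologicalType) (T : X -> Y -> Prop) : Prop := {
  irr_total : forall x, exists y, T x y;
  irr_closed : forall A, closed A -> closed (rel_image T A);
  irr_dense : forall U, open U -> U !=set0 ->
    exists V, [/\ open V, V !=set0 & rel_image (converse T) V `<=` U] }.

Section IrreducibleRel.
Context (X Y : topologicalType) (T : X -> Y -> Prop).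
Hypotheses (irrT : irreducible_rel T) (irrT' : irreducible_rel (converse T)).

(** [V] contains the whole image of some open [U], and [U] minus [A] contains everything related to
    some open [W]. Points of [W] then lie in [V] and off the image of [A]. *)
Lemma rel_image_nowhere_dense (A : set X) :
  closed A -> nowhere_dense A -> nowhere_dense (rel_image T A).
Proof.
move=> cA /(closed_nowhere_dense cA) ndA.
apply/(closed_nowhere_dense (irr_closed irrT cA)) => V oV V0.
have [U [oU U0 UV]] := irr_dense irrT' oV V0.
have oUA : open (U `\` A) by apply: openI => //; exact: closed_openC.
have [W [oW [y Wy] WU]] := irr_dense irrT oUA (ndA _ oU U0).
have [x Txy] := irr_total irrT' y.
have [Ux nAx] : (U `\` A) x by apply: WU; exists y.
exists y; split; first by apply: UV; exists x.
move=> [x' Ax' Tx'y]; have [_] : (U `\` A) x' by apply: WU; exists y.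
by apply.
Qed.

(** The intersection of the images may exceed the image of the intersection. But a point of [U]
    outside the intersection misses [C] or [D], and [key] for that set gives a point of [V] off its
    image. *)
Lemma rel_image_split (C D : set X) : closed C -> closed D ->
  nowhere_dense (C `&` D) -> nowhere_dense (rel_image T C `&` rel_image T D).
Proof.
move=> cC cD /(closed_nowhere_dense (closedI cC cD)) ndCD.
apply/closed_nowhere_dense; first by apply: closedI; exact: (irr_closed irrT).
move=> V oV V0; have [U [oU U0 UV]] := irr_dense irrT' oV V0.
have key (E : set X) : closed E -> U `\` E !=set0 -> V `\` rel_image T E !=set0.
  move=> cE UE0; have oUE : open (U `\` E) by apply: openI => //; exact: closed_openC.
  have [W [oW [y Wy] WU]] := irr_dense irrT oUE UE0.
  have [x Txy] := irr_total irrT' y.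
  have [Ux nEx] : (U `\` E) x by apply: WU; exists y.
  exists y; split; first by apply: UV; exists x.
  move=> [x' Ex' Tx'y]; have [_] : (U `\` E) x' by apply: WU; exists y.
  by apply.
have [x [Ux nCDx]] := ndCD _ oU U0.
have [Cx|nCx] := pselect (C x).
  have [||y [Vy nDy]] := key D => //; first by exists x; split => // Dx; apply: nCDx.
  by exists y; split => // -[].
have [||y [Vy nDy]] := key C => //; first by exists x.
by exists y; split => // -[].
Qed.

Lemma rel_image_neq0 (A : set X) : A !=set0 -> rel_image T A !=set0.
Proof. by move=> [x Ax]; have [y Txy] := irr_total irrT x; exists y, x. Qed.

End IrreducibleRel.

(** * Transport of remote points along an irreducible relation *)

Section RemoteLink.
Context (R : realType) (X Y : topologicalType) (T : X -> Y -> Prop).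
Hypotheses (irrT : irreducible_rel T) (irrT' : irreducible_rel (converse T)).
Hypotheses (uX : has_urysohn R X) (uY : has_urysohn R Y).
Hypothesis point_nowhere_dense : forall y : Y, nowhere_dense [set y].

(* This asymmetric condition turns out to be symmetric (lemma
   [remote_link_converse]), which makes the induced map bijective. *)
Definition remote_link (p : stone_cech R X) (q : stone_cech R Y) : Prop :=
  forall A, closed A -> beta_closure A p -> beta_closure (rel_image T A) q.

(** Otherwise the trace [G] of a closed neighbourhood of [p] misses everything related to [B]. Then
    [B] and the image of [G] are disjoint closed sets with [q] in both closures. *)
Lemma remote_link_converse p q : remote_link p q ->
  forall B, closed B -> beta_closure B q ->
  beta_closure (rel_image (converse T) B) p.
Proof.
move=> pq B cB Bq; apply: contrapT => /beta_closure_separate[G [cG BG0 tG]].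
have Gp : beta_closure G p by rewrite -[G]setTI; apply/tG/beta_closureT.
have [|y [By [x Gx Txy]]] := beta_closure_meets uY cB _ Bq (pq _ cG Gp).
  exact: irr_closed.
by rewrite -[False]/(set0 x) -BG0; split => //; exists y.
Qed.

(** For the converse direction, split [Y] into [C] containing [B] and [D], with [q] in the closure
    of [D] only. Then [p] lies in the closures of both preimages, hence in that of their nowhere
    dense intersection, against remoteness. *)
Lemma remote_linkE p q (B : set Y) : remote_points R X p -> remote_link p q ->
  closed B -> beta_closure B q <-> beta_closure (rel_image (converse T) B) p.
Proof.
move=> [_ rp] pq cB; split; first exact: remote_link_converse.
move=> TBp; apply: contrapT => /beta_closure_split.
move=> [C [D [cC cD CD nd [BC nCq]]]].
have Dq : beta_closure D q.
  by have := @beta_closureT R Y q; rewrite -CD beta_closureU => -[].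
have TCp : beta_closure (rel_image (converse T) C) p.
  by apply: beta_closureS TBp => x [y /BC Cy Tyx]; exists y.
have TDp := remote_link_converse pq cD Dq.
apply: (rp _ (rel_image_split irrT' irrT cC cD nd)).
by apply: beta_closureI => //; exact: irr_closed.
Qed.

Lemma remote_link_unique p q q' : remote_points R X p ->
  remote_link p q -> remote_link p q' -> q = q'.
Proof.
move=> rp pq pq'; apply: contrapT => /beta_neq[B [cB nBq Bq']].
by apply/nBq/(remote_linkE rp pq cB)/(remote_linkE rp pq' cB).
Qed.

Lemma remote_link_exists p : remote_points R X p ->
  exists2 q, remote_points R Y q & remote_link p q.
Proof.
move=> [_ rp].
(* Supersets of images are included because the image of [A] intersected with [A'] may be smaller
   than the intersection of the images. *)
have [|||q Sq] := @beta_compact R Y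
  [set B | exists A, [/\ closed A, beta_closure A p & rel_image T A `<=` B]].
- by exists setT, setT; split; [exact: closedT|exact: beta_closureT|].
- move=> B [A [_ /beta_closure_neq0 /(rel_image_neq0 irrT) [y TAy] AB]].
  by exists y; exact: AB.
- move=> B B' [A [cA Ap AB]] [A' [cA' Ap' AB']].
  exists (A `&` A'); split; [exact: closedI|exact: beta_closureI|].
  by move=> y [x [Ax A'x] Txy]; split; [apply: AB; exists x|apply: AB'; exists x].
have pq : remote_link p q by move=> A cA Ap; apply: Sq; exists A; split.
have rq (N : set Y) : nowhere_dense N -> ~ beta_closure N q.
  move=> ndN /(beta_closureS (@subset_closure _ N)) Nq.
  have cN := @closed_closure _ N.
  apply: (rp (rel_image (converse T) (closure N))).
    apply: (rel_image_nowhere_dense irrT' irrT) => //.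
    by rewrite /nowhere_dense -((closure_id _).1 cN).
  exact (remote_link_converse pq cN Nq).
(* A point coming from [Y] would adhere to a singleton, which is nowhere dense. *)
exists q => //; split => // -[y _ yq].
by apply: (rq _ (point_nowhere_dense y)); rewrite -yq; exact: beta_closure_self.
Qed.

End RemoteLink.

Section Homeomorphism.
Context (R : realType).

(** By [remote_linkE], the preimage of a basic closed set is again the trace of a closure, whence
    continuity. *)
Lemma remote_map_exists (X Y : topologicalType) (T : X -> Y -> Prop) :
  irreducible_rel T -> irreducible_rel (converse T) ->
  has_urysohn R X -> has_urysohn R Y ->
  (forall y : Y, nowhere_dense [set y]) ->
  exists2 f : set_type (remote_points R X) -> set_type (remote_points R Y),
    (forall p, remote_link T (\val p) (\val (f p))) & continuous f.
Proof.
move=> irrT irrT' uX uY ndY.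
have /choice[f fP] (p : set_type (remote_points R X)) :
    exists q : set_type (remote_points R Y), remote_link T (\val p) (\val q).
  have [q rq pq] := remote_link_exists irrT irrT' uX uY ndY (set_mem (valP p)).
  by exists (SigSub (mem_set rq)).
exists f => // p V [W [[O oO <-]] /= Ofp OV].
have [B [cB nB OB]] := beta_closed_base oO Ofp.
have linkE p' := remote_linkE irrT irrT' uX uY (set_mem (valP p')) (fP p') cB.
exists (set_val @^-1` (~` beta_closure (rel_image (converse T) B))); split.
- exists (~` beta_closure (rel_image (converse T) B)) => //.
  by apply: closed_openC; exact: closed_closure.
- by move=> /= /linkE.
- move=> p' /= np'; apply: OV; apply: contrapT => /OB /linkE.
  exact: np'.
Qed.

(** The maps induced by [T] and by its converse are mutually inverse, since links reverse and are
    unique. *)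
Lemma remote_points_homeomorphic (X Y : topologicalType) (T : X -> Y -> Prop) :
  irreducible_rel T -> irreducible_rel (converse T) ->
  has_urysohn R X -> has_urysohn R Y ->
  (forall x : X, nowhere_dense [set x]) ->
  (forall y : Y, nowhere_dense [set y]) ->
  homeomorphic (set_type (remote_points R X)) (set_type (remote_points R Y)).
Proof.
move=> irrT irrT' uX uY ndX ndY.
have [f fP cf] := remote_map_exists irrT irrT' uX uY ndY.
have [g gP cg] := remote_map_exists irrT' irrT uY uX ndX.
exists f, g; split => // [p|q]; apply: val_inj.
- apply: (remote_link_unique irrT' irrT uY uX (set_mem (valP (f p))) (gP _)).
  exact (remote_link_converse irrT uY (fP p)).
- apply: (remote_link_unique irrT irrT' uX uY (set_mem (valP (g q))) (fP _)).
  exact (remote_link_converse irrT' uX (gP q)).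
Qed.

End Homeomorphism.

(** * Trees of open sets with compact pieces *)

(* A node is a list read from the leaf to the root: the children of [s] are the
   lists [i :: s].  The compact pieces [F s] cover the space, and the open sets
   [W (i :: s)] accumulate only at [F s]. *)
Record scheme (X : topologicalType) (W F : seq nat -> set X) : Prop := {
  scheme_root : W [::] = setT;
  scheme_open : forall s, open (W s);
  scheme_neq0 : forall s, W s !=set0;
  scheme_child : forall s i, W (i :: s) `<=` W s;
  scheme_child_piece : forall s i, closure (W (i :: s)) `&` F s = set0;
  scheme_disjoint : forall s i j, W (i :: s) `&` W (j :: s) !=set0 -> i = j;
  scheme_piece_neq0 : forall s, F s !=set0;
  scheme_piece : forall s, F s `<=` closure (W s);
  scheme_cover : forall s x,
    closure (W s) x -> F s x \/ exists i, closure (W (i :: s)) x;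
  scheme_far : forall s (A : set X), closed A -> A `&` F s = set0 ->
    exists N, forall i, (N <= i)%N -> A `&` closure (W (i :: s)) = set0;
  scheme_locally_finite : forall s x, ~ F s x -> exists O, [/\ open O, O x,
    O `&` F s = set0 & exists N, forall i, (N <= i)%N ->
      O `&` closure (W (i :: s)) = set0];
  scheme_level : forall x, exists n, forall s, size s = n ->
    closure (W s) x -> F s x;
  scheme_dense : forall U, open U -> U !=set0 ->
    exists s, closure (W s) `<=` U }.

Section SchemeTheory.
Context (X : topologicalType) (W F : seq nat -> set X) (sch : scheme W F).

Lemma scheme_cat s t : W (t ++ s) `<=` W s.
Proof.
elim: t => [|i t IH] //=.
by apply: subset_trans IH; exact: (scheme_child sch).
Qed.

Lemma scheme_piece_cat s t : F (t ++ s) `<=` closure (W s).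
Proof.
move=> x /(scheme_piece sch); apply: closureS.
exact: scheme_cat.
Qed.

(** By induction [t] passes through the parent of the node. It cannot stop there, as the closure of
    a child misses the parent's piece, and it cannot enter another child, as siblings are disjoint
    open sets. *)
Lemma scheme_piece_suffix s t x : W s x -> F t x -> exists u, t = u ++ s.
Proof.
move=> + Ftx; elim: s => [|i s IH] Wx; first by exists t; rewrite cats0.
have [u tE] := IH (scheme_child sch Wx).
(* The last entry of [u] is the child of [s] through which [t] passes. *)
case: (lastP u) tE => [|{}u j] tE.
  have : (closure (W (i :: s)) `&` F s) x.
    by split; [exact: subset_closure|rewrite tE in Ftx].
  by rewrite (scheme_child_piece sch).
exists u; rewrite tE cat_rcons; congr (_ ++ _ :: _).
rewrite tE cat_rcons in Ftx.
have [y [Wjy Wiy]] :=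
  scheme_piece_cat Ftx (open_nbhs_nbhs (conj (scheme_open sch (i :: s)) Wx)).
by apply: (scheme_disjoint sch (s := s)); exists y.
Qed.

(** A point in no piece would lie in the closure of a node at every level, contradicting
    [scheme_level]. *)
Lemma scheme_piece_cover x : exists s, F s x.
Proof.
have [n nP] := scheme_level sch x; apply: contrapT => nF.
suff [s [sn Wsx]] : exists s, size s = n /\ closure (W s) x.
  by apply: nF; exists s; exact: nP.
elim: (n) => [|m [s [sm Wsx]]].
  exists [::]; split => //; rewrite (scheme_root sch).
  by rewrite closureT.
have [Fsx|[i Wisx]] := scheme_cover sch Wsx; first by case: nF; exists s.
by exists (i :: s); rewrite /= sm.
Qed.

End SchemeTheory.

(** * The relation between two trees *)

Definition piece_rel (X Y : Type) (F : seq nat -> set X) (G : seq nat -> set Y)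
  (x : X) (y : Y) : Prop := exists s, F s x /\ G s y.

Section PieceRel.
Context (X Y : topologicalType) (W F : seq nat -> set X) (V G : seq nat -> set Y).
Hypotheses (schX : scheme W F) (schY : scheme V G).

Lemma nbhs_forall_lt (y : Y) (P : nat -> set Y -> Prop) N :
  (forall i (O O' : set Y), O' `<=` O -> P i O -> P i O') ->
  (forall i, exists2 O, nbhs y O & P i O) ->
  exists2 O, nbhs y O & forall i, (i < N)%N -> P i O.
Proof.
move=> Psub nP; elim: N => [|N [O nO OP]]; first by exists setT => //; exact: filterT.
have [O' nO' PO'] := nP N.
exists (O `&` O'); first exact: filterI.
move=> i; rewrite ltnS leq_eqVlt => /predU1P[->|/OP PO].
  by apply: Psub PO' => z [].
by apply: Psub PO => z [].
Qed.

(** For [y] outside the image, a neighbourhood must miss each piece of [Y] whose twin in [X] meets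
    [A]. It is built subtree by subtree, from level [n] up to the root, beyond which the level of
    [y] leaves nothing to treat. *)
Lemma piece_rel_closed (A : set X) :
  closed A -> closed (rel_image (piece_rel F G) A).
Proof.
move=> cA y Ay; apply: contrapT => nAy; have [n nP] := scheme_level schY y.
suff [O nO OG] : exists2 O, nbhs y O &
    forall t, F (t ++ [::]) `&` A !=set0 -> O `&` G (t ++ [::]) = set0.
  have [z [[x Ax [t [Fx Gz]]] Oz]] := Ay _ nO.
  by rewrite -[False]/(set0 z) -(OG t) ?cats0 //; exists x.
have outside s : ~ closure (V s) y -> exists2 O, nbhs y O &
    forall t, F (t ++ s) `&` A !=set0 -> O `&` G (t ++ s) = set0.
  move=> nVy; exists (~` closure (V s)).
    by apply: open_nbhs_nbhs; split => //; apply: closed_openC; exact: closed_closure.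
  by move=> t _; apply/seteqP; split => // z [nz /(scheme_piece_cat schY)].
(* Here [F s] misses [A], so only finitely many children in [X] reach [A]; the closures of their
   twins in [Y] avoid [y] and can be removed. *)
have inside s : G s y -> exists2 O, nbhs y O &
    forall t, F (t ++ s) `&` A !=set0 -> O `&` G (t ++ s) = set0.
  move=> Gsy; have AF0 : A `&` F s = set0.
    by apply/seteqP; split => // x [Ax Fx]; apply: nAy; exists x => //; exists s.
  have [N NP] := scheme_far schX cA AF0.
  have [|i|O nO OP] := @nbhs_forall_lt y
    (fun i O => O `&` closure (V (i :: s)) = set0) N.
  - move=> i O O' O'O /seteqP[OV _]; apply/seteqP; split => // z [/O'O Oz Vz].
    exact: (OV z).
  - exists (~` closure (V (i :: s))); last by rewrite setICl.
    apply: open_nbhs_nbhs; split; first by apply: closed_openC; exact: closed_closure.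
    move=> Vy; have : (closure (V (i :: s)) `&` G s) y by [].
    by rewrite (scheme_child_piece schY).
  exists O => // t; case: (lastP t) => [|{}t i] [x [Fx Ax]].
    by have : (A `&` F s) x by []; rewrite AF0.
  rewrite cat_rcons in Fx *; have [iN|Ni] := ltnP i N.
    apply/seteqP; split => // z [Oz /(scheme_piece_cat schY) Vz].
    by rewrite -(OP _ iN).
  have : (A `&` closure (W (i :: s))) x.
    by split => //; exact: (scheme_piece_cat schX) Fx.
  by rewrite NP.
suff main m s : (n <= size s + m)%N -> (size s <= n)%N -> exists2 O, nbhs y O &
    forall t, F (t ++ s) `&` A !=set0 -> O `&` G (t ++ s) = set0.
  exact: (main n).
elim: m s => [|m IH] s.
  rewrite addn0 => ns sn; have [Vsy|/outside//] := pselect (closure (V s) y).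
  by apply/inside/nP => //; apply/eqP; rewrite eqn_leq sn.
move=> nsm sn; have [Vsy|/outside//] := pselect (closure (V s) y).
have [/inside//|nGsy] := pselect (G s y).
have [sn'|ns] := ltnP (size s) n; last first.
  by case: nGsy; apply: nP => //; apply/eqP; rewrite eqn_leq sn ns.
(* Off [G s], a neighbourhood of [y] meets only finitely many children of [s], each settled by
   induction. *)
have [O [oO Oy OG0 [N NP]]] := scheme_locally_finite schY nGsy.
have [|i|O' nO' O'P] := @nbhs_forall_lt y
  (fun i O => forall t, F (t ++ i :: s) `&` A !=set0 ->
     O `&` G (t ++ i :: s) = set0) N.
- move=> i B B' B'B BP t FA; apply/seteqP; split => // z [/B'B Bz Gz].
  by rewrite -(BP t FA).
- by apply: IH; rewrite /= ?addSnnS.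
exists (O `&` O'); first by apply: filterI => //; exact: open_nbhs_nbhs.
move=> t; case: (lastP t) => [|{}t i] FA.
  by rewrite /= setIAC OG0 set0I.
rewrite cat_rcons in FA *; have [iN|Ni] := ltnP i N.
  by rewrite -setIA O'P ?setI0.
apply/seteqP; split => // z [[Oz _] /(scheme_piece_cat schY) Vz].
by rewrite -(NP _ Ni).
Qed.

Lemma piece_rel_irreducible : irreducible_rel (piece_rel F G).
Proof.
split.
- move=> x; have [s Fsx] := scheme_piece_cover schX x.
  by have [y Gsy] := scheme_piece_neq0 schY s; exists y, s.
- exact: piece_rel_closed.
- move=> U oU U0; have [s WU] := scheme_dense schX oU U0.
  exists (V s); split; [exact: (scheme_open schY)|exact: (scheme_neq0 schY)|].
  move=> x [y Vy [t [Ftx Gty]]]; apply: WU.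
  have [u tE] := scheme_piece_suffix schY Vy Gty.
  by rewrite tE in Ftx; exact: (scheme_piece_cat schX) Ftx.
Qed.

End PieceRel.

(** * Existence of trees in metrizable spaces *)

Lemma nowhere_locally_compactD (X : topologicalType) (A U : set X) :
  nowhere_locally_compact X -> compact A -> open U -> U !=set0 ->
  U `\` A !=set0.
Proof.
move=> nX cA oU [x Ux]; apply: contrapT => nUA; apply: (nX x); exists A => //.
apply: (@filterS _ _ _ U); last exact: open_nbhs_nbhs.
by move=> y Uy; apply: contrapT => nAy; apply: nUA; exists y.
Qed.

Section Metric.
Context (R : realType) (X : topologicalType) (d : X -> X -> R).
Hypotheses (d0P : forall x y, d x y = 0 <-> x = y)
  (dC : forall x y, d x y = d y x)
  (d_triangle : forall x y z, d x z <= d x y + d y z)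
  (nbhs_d : forall x (A : set X),
     nbhs x A <-> exists2 e : R, 0 < e & [set y | d x y < e] `<=` A).

Lemma d_refl x : d x x = 0. Proof. exact/d0P. Qed.

Lemma d_ge0 x y : 0 <= d x y.
Proof. by have := d_triangle x y x; rewrite d_refl (dC y x) -mulr2n pmulrn_lge0. Qed.

Lemma nbhs_d_ball x e : 0 < e -> nbhs x [set y | d x y < e].
Proof. by move=> e0; apply/nbhs_d; exists e. Qed.

Lemma open_d_ball x e : open [set y | d x y < e].
Proof.
rewrite openE => y /= xye; apply/nbhs_d; exists (e - d x y).
  by rewrite subr_gt0.
move=> z /=; rewrite ltrBrDl; exact: le_lt_trans.
Qed.

Lemma metric_hausdorff : hausdorff_space X.
Proof.
move=> x y xy; apply/d0P/eqP; rewrite eq_le d_ge0 andbT leNgt; apply/negP => dxy.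
have e0 : 0 < d x y / 2 by rewrite divr_gt0.
have [z /= [xz yz]] := xy _ _ (nbhs_d_ball x e0) (nbhs_d_ball y e0).
have := le_lt_trans (d_triangle x z y) (ltrD xz _ : _ < d x y / 2 + d x y / 2).
by rewrite dC => /(_ yz); rewrite -splitr ltxx.
Qed.

Lemma metric_regular x (O : set X) : open O -> O x ->
  exists V, [/\ open V, V x & closure V `<=` O].
Proof.
move=> oO Ox; have /nbhs_d[e e0 eO] := open_nbhs_nbhs (conj oO Ox).
exists [set y | d x y < e / 2]; split.
- exact: open_d_ball.
- by rewrite /= d_refl divr_gt0.
- have e20 : 0 < e / 2 by rewrite divr_gt0.
  move=> y /(_ _ (nbhs_d_ball y e20))[z /= [xz yz]]; apply: eO => /=.
  by rewrite (splitr e) (le_lt_trans (d_triangle x z y))// ltrD// dC.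
Qed.

(** * Distance to a set *)

Definition dist (A : set X) x : R := inf [set d x a | a in A].

Section Dist.
Variables (A : set X) (A0 : A !=set0).

Let dist_has_inf x : has_inf [set d x a | a in A].
Proof.
split; first by have [a Aa] := A0; exists (d x a), a.
by exists 0 => _ [a _ <-]; exact: d_ge0.
Qed.

Lemma dist_ge0 x : 0 <= dist A x.
Proof.
apply: lb_le_inf; first by have [] := dist_has_inf x.
by move=> _ [a _ <-]; exact: d_ge0.
Qed.

Lemma dist_le x a : A a -> dist A x <= d x a.
Proof. by move=> Aa; apply: ge_inf; [have [] := dist_has_inf x|exists a]. Qed.

Lemma dist_lt x e : dist A x < e -> exists2 a, A a & d x a < e.
Proof.
by move=> /(inf_lt (dist_has_inf x).1)[_ [a Aa <-] xae]; exists a.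
Qed.

Lemma dist_lip x y : dist A x <= d x y + dist A y.
Proof.
rewrite -lerBlDl; apply: lb_le_inf; first by have [] := dist_has_inf y.
move=> _ [a Aa <-]; rewrite lerBlDl.
exact: le_trans (dist_le _ Aa) (d_triangle _ _ _).
Qed.

Lemma dist_continuous : continuous (dist A).
Proof.
move=> x; apply/cvgrPdist_lt => e e0; near=> y.
have xye : d x y < e by near: y; exact: nbhs_d_ball.
apply: le_lt_trans xye; have := dist_lip x y; have := dist_lip y x.
rewrite (dC y x) ler_norml => ? ?; apply/andP; split; lra.
Unshelve. all: by end_near. Qed.

Lemma dist_eq0 x : A x -> dist A x = 0.
Proof. by move=> Ax; apply/eqP; rewrite eq_le dist_ge0 -(d_refl x) dist_le. Qed.

Lemma dist_gt0 x : closed A -> ~ A x -> 0 < dist A x.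
Proof.
move=> cA nAx; rewrite lt_neqAle dist_ge0 andbT; apply/negP => /eqP e0.
apply/nAx/cA => B /nbhs_d[e epos eB].
by have [|a Aa xa] := @dist_lt x e; [rewrite -e0|exists a; split => //; exact: eB].
Qed.

Lemma open_dist_gt r : open [set x | r < dist A x].
Proof.
apply: (@open_comp _ _ (dist A) [set y | r < y]); last exact: open_gt.
by move=> x _; exact: dist_continuous.
Qed.

Lemma closed_dist_le r : closed [set x | dist A x <= r].
Proof.
apply: (@closed_comp _ _ (dist A) [set y | y <= r]); last exact: closed_le.
by move=> x _; exact: dist_continuous.
Qed.

Lemma closed_dist_ge r : closed [set x | r <= dist A x].
Proof.
apply: (@closed_comp _ _ (dist A) [set y | r <= y]); last exact: closed_ge.
by move=> x _; exact: dist_continuous.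
Qed.

End Dist.

Lemma metric_urysohn : has_urysohn R X.
Proof.
move=> A B cA cB AB0.
(* The facts on [dist] need a nonempty set, so empty sets get constant functions. *)
have [A0|/eqP/set0P A0] := pselect (A = set0).
  exists (fun=> 1); split; [exact: cst_continuous|by rewrite ler01 lexx| |by []].
  by rewrite A0.
have [B0|/eqP/set0P B0] := pselect (B = set0).
  exists (fun=> 0); split; [exact: cst_continuous|by rewrite ler01 lexx|by []|].
  by rewrite B0.
have pos x : 0 < dist A x + dist B x.
  have [Ax|nAx] := pselect (A x).
    rewrite ltr_wpDl ?dist_ge0// dist_gt0// => Bx.
    by rewrite -[False]/(set0 x) -AB0.
  by rewrite ltr_pwDl ?dist_ge0// dist_gt0.
exists (fun x => dist A x / (dist A x + dist B x)); split.
- move=> x; apply: continuousM; first exact: dist_continuous.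
  apply: continuousV; first by rewrite gt_eqF.
  by apply: continuousD; exact: dist_continuous.
- move=> x; rewrite divr_ge0 ?dist_ge0 ?(ltW (pos x))//=.
  by rewrite ler_pdivrMr// mul1r lerDl dist_ge0.
- by move=> x /(dist_eq0 A0) ->; rewrite mul0r.
- by move=> x Bx; have := pos x; rewrite (dist_eq0 B0 Bx) addr0 => ?; rewrite divff// gt_eqF.
Qed.

(** Each point of [F] has positive distance to [A], and so do nearby points, with a common bound;
    compactness makes the bound uniform. *)
Lemma compact_dist_gt0 (F A : set X) : compact F -> F !=set0 -> closed A ->
  A `&` F = set0 -> exists k : nat, forall a, A a -> k.+1%:R^-1 < dist F a.
Proof.
move=> cF F0 cA AF0; have [->|/eqP/set0P A0] := pselect (A = set0).
  by exists 0%N.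
have := (compact_near_coveringP F).1 cF nat \oo
  (fun k x => k.+1%:R^-1 < dist A x).
have step x : F x -> \forall x' \near x & k \near \oo, k.+1%:R^-1 < dist A x'.
  move=> Fx; have ge : 0 < dist A x.
    by apply: dist_gt0 => // Ax; rewrite -[False]/(set0 x) -AF0.
  have [k0] := ltr_add_invr ge; rewrite add0r => k0P.
  near=> x' k => /=; apply: (@le_lt_trans _ _ k0.+1%:R^-1).
    by rewrite lef_pV2 ?posrE// ler_nat ltnS; near: k; exact: nbhs_infty_ge.
  by near: x'; exact: (open_nbhs_nbhs (conj (open_dist_gt A0 _) k0P)).
move=> /(_ _ step)[N _ /(_ N (leqnn N)) NP]; exists N.+1 => a Aa.
apply: (@lt_le_trans _ _ N.+1%:R^-1).
  by rewrite ltf_pV2 ?posrE// ltr_nat.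
rewrite leNgt; apply/negP => /(dist_lt F0)[f Ff].
by rewrite dC => /(le_lt_trans (dist_le A0 f Aa)); rewrite ltNge (ltW (NP f Ff)).
Unshelve. all: by end_near. Qed.

Definition covers_within (e : R) (s : seq X) : set X :=
  [set x | exists2 y, y \in s & d x y < e].

(** Without a finite net, the complements of finite unions of balls generate a proper filter on [K];
    a ball around a cluster point of it gives a contradiction. *)
Lemma compact_net (K : set X) e : compact K -> 0 < e ->
  exists s, K `<=` covers_within e s.
Proof.
move=> cK e0; apply: contrapT => nK.
pose F := filter_from setT (fun s => K `\` covers_within e s).
have PF : ProperFilter F.
  apply: filter_from_proper => [|s _]; last first.
    apply: contrapT => KF0; apply: nK; exists s => x Kx.
    by apply: contrapT => nx; apply: KF0; exists x.
  apply: filter_from_filter; first by exists [::].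
  move=> s t _ _; exists (s ++ t) => // x [Kx nx].
  split; split => // -[y yst xy]; apply: nx; exists y => //.
    by rewrite mem_cat yst.
  by rewrite mem_cat yst orbT.
have [|x [Kx Fx]] := cK F PF; first by exists [::] => // x [].
have [|y [[_ nxy] xy]] := Fx (K `\` covers_within e [:: x]) _ _ (nbhs_d_ball x e0).
  by exists [:: x].
by apply: nxy; exists x; rewrite ?mem_head// dC.
Qed.

Lemma sigma_compact_pi_base : sigma_compact X -> exists U : nat -> set X,
  (forall n, open (U n)) /\
  forall O, open O -> O !=set0 -> exists n, U n !=set0 /\ U n `<=` O.
Proof.
move=> [K cK KT].
have /choice[c cP] (nk : nat * nat) :
    exists s, K nk.1 `<=` covers_within nk.2.+1%:R^-1 s.
  by apply: compact_net => //; rewrite invr_gt0.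
pose b (m : nat * nat * nat) : set X := if c m.1 is x0 :: _
  then [set y | d (nth x0 (c m.1) m.2) y < m.1.2.+1%:R^-1] else set0.
pose U n : set X := if unpickle n is Some m then b m else set0.
exists U; split.
  move=> n; rewrite /U; case: (unpickle n) => [m|]; last exact: open0.
  rewrite /b; case: (c m.1) => [|x0 s]; first exact: open0.
  exact: open_d_ball.
move=> O oO [x Ox]; have /nbhs_d[e e0 eO] := open_nbhs_nbhs (conj oO Ox).
have e20 : 0 < e / 2 by rewrite divr_gt0.
have [k] := ltr_add_invr e20; rewrite add0r => ke.
have [n _ Knx] : (\bigcup_n K n) x by rewrite KT.
have [y yc xy] := cP (n, k) x Knx.
exists (pickle (n, k, index y (c (n, k)))).
have UE z : U (pickle (n, k, index y (c (n, k)))) z = (d y z < k.+1%:R^-1) :> Prop.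
  rewrite /U pickleK /b /=; case E : (c (n, k)) => [|x0 s]; first by rewrite E in yc.
  by rewrite -E nth_index.
split; first by exists x; rewrite UE dC.
move=> z; rewrite UE => yz; apply: eO => /=; rewrite (splitr e).
apply: (le_lt_trans (d_triangle x y z)).
by rewrite ltrD// (lt_trans _ ke).
Qed.

(* The child [V 0] serves to enter a member [U] of a pi-base; the other children
   are layers by distance to [F]. *)
Record branching (K U W F : set X) (V : nat -> set X) : Prop := {
  branch_compact : compact F;
  branch_neq0 : F !=set0;
  branch_piece : F `<=` closure W;
  branch_captures : K `&` closure W `<=` F;
  branch_open : forall i, open (V i);
  branch_child_neq0 : forall i, V i !=set0;
  branch_child : forall i, V i `<=` W;
  branch_child_piece : forall i, closure (V i) `&` F = set0;
  branch_disjoint : forall i j, V i `&` V j !=set0 -> i = j;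
  branch_cover : forall x, closure W x -> F x \/ exists i, closure (V i) x;
  branch_layers : forall (k i : nat), (k.+1 < i)%N ->
    closure (V i) `<=` [set x | dist F x <= k.+1%:R^-1];
  branch_small : U `&` W !=set0 -> closure (V 0%N) `<=` U }.

Hypothesis nlcX : nowhere_locally_compact X.

Lemma branching_exists (K U W : set X) : compact K -> open U -> open W ->
  W !=set0 -> exists F V, branching K U W F V.
Proof.
move=> cK oU oW W0; have hX := metric_hausdorff.
(* The point [x0] keeps [F] nonempty and, lying in [W], prevents the layers from exhausting [W]. *)
have [x0 Wx0] := W0; pose F := (K `&` closure W) `|` [set x0].
have cptF : compact F.
  apply: compactU; last exact: compact_set1.
  by apply: compact_closedI => //; exact: closed_closure.
have cF : closed F by exact: compact_closed.
have F0 : F !=set0 by exists x0; right.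
have gF x : ~ F x -> exists k : nat, k.+1%:R^-1 < dist F x.
  move=> nFx; have [k] := ltr_add_invr (dist_gt0 F0 cF nFx).
  by rewrite add0r; exists k.
have [D0 [oD0 D00 D0W D0F D0U]] : exists D0, [/\ open D0, D0 !=set0, D0 `<=` W,
    closure D0 `&` F = set0 & U `&` W !=set0 -> closure D0 `<=` U].
  have [U' [oU' U'0 U'W U'U]] : exists U', [/\ open U', U' !=set0, U' `<=` W &
      U `&` W !=set0 -> U' `<=` U].
    have [UW|UW] := pselect (U `&` W !=set0); last by exists W; split.
    by exists (U `&` W); split;
      [exact: openI|by []|by move=> x []|by move=> _ x []].
  have [z [U'z nFz]] := nowhere_locally_compactD nlcX cptF oU' U'0.
  have [D [oD Dz DU]] : exists D, [/\ open D, D z & closure D `<=` U' `\` F].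
    by apply: metric_regular => //; apply: openI => //; exact: closed_openC.
  exists D; split => //; first by exists z.
  - by move=> x /subset_closure/DU[/U'W].
  - by apply/seteqP; split => // x [/DU[_ nFx] /nFx].
  - by move=> /U'U U'U0 x /DU[/U'U0].
pose inv (D : set X) := [/\ open D, D `<=` W & closure D `&` F = set0].
(* The children will be successive differences of growing open sets [D]. Each step must enlarge [D]
   beyond its closure and include all of [W] farther than [k.+1%:R^-1] from [F]. *)
have /choice[next nextP] (kD : nat * set X) : exists D', inv kD.2 ->
    [/\ inv D', kD.2 `<=` D', D' `\` closure kD.2 !=set0 &
      W `&` [set x | kD.1.+1%:R^-1 < dist F x] `<=` D'].
  case: kD => k D /=; have [|ninv] := pselect (inv D); last by exists set0.
  move=> [oD DW DF].
  have [y [[Wy nDy] nFy]] : (W `\` closure D) `\` F !=set0.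
    apply: nowhere_locally_compactD => //.
      by apply: openI => //; apply: closed_openC; exact: closed_closure.
    exists x0; split => // Dx0; rewrite -[False]/(set0 x0) -DF.
    by split => //; right.
  (* The first bound puts the new point [y] into the enlarged set, the second includes the required
     layer. *)
  have [m mP] := gF y nFy; pose r : R := Num.min m.+1%:R^-1 k.+1%:R^-1.
  have r0 : 0 < r by rewrite lt_min !invr_gt0 !ltr0n.
  exists (D `|` (W `&` [set x | r < dist F x])) => _; split.
  - split.
    + by apply: openU => //; apply: openI => //; exact: open_dist_gt.
    + by move=> x [/DW|[]].
    + apply/seteqP; split => // x; rewrite closureU => -[[Dx|Wx] Fx].
        by rewrite -DF.
      have : [set x | r <= dist F x] x.
        rewrite ((closure_id _).1 (@closed_dist_ge _ F0 r)).
        by apply: closureS Wx => z [_ /= /ltW].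
      by rewrite /= (dist_eq0 F0 Fx) leNgt r0.
  - by move=> x; left.
  - exists y; split => //; right; split => //=.
    by apply: le_lt_trans mP; rewrite ge_min lexx.
  - move=> x [Wx xr]; right; split => //=.
    by apply: le_lt_trans xr; rewrite ge_min lexx orbT.
pose fix D n := if n is k.+1 then next (k, D k) else D0.
have Dinv n : inv (D n) by elim: n => [//|n /(nextP (n, _))[]].
have DS n : D n `<=` D n.+1 by have [] := nextP (n, D n) (Dinv n).
have DSne n : D n.+1 `\` closure (D n) !=set0 by have [] := nextP (n, D n) (Dinv n).
have Dlayer n : W `&` [set x | n.+1%:R^-1 < dist F x] `<=` D n.+1.
  by have [] := nextP (n, D n) (Dinv n).
have Dmono m n : (m <= n)%N -> D m `<=` D n.
  move=> /subnK <-; elim: (n - m)%N => [//|k IH].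
  exact: subset_trans IH (DS _).
pose V i := if i is k.+1 then D k.+1 `\` closure (D k) else D0.
have VD i : V i `<=` D i by case: i => [|i] //= x [].
have VnD i j : (j < i)%N -> V i `<=` ~` closure (D j).
  case: i => [//|i]; rewrite ltnS => ji x [_ nDx] Djx; apply: nDx.
  exact: closureS (Dmono _ _ ji) _ Djx.
have Vdisj i j : (j < i)%N -> V i `&` V j = set0.
  move=> ji; apply/seteqP; split => // x [/(VnD _ _ ji) + /VD Dx].
  by apply; exact: subset_closure.
(* The closure of [D n.+1] is covered by those of [V n.+1] and [D n], so induction descends to
   [D0]. *)
have Dcover n x : closure (D n) x -> exists i, closure (V i) x.
  elim: n => [|n IH]; first by exists 0%N.
  move=> Dx; have : closure (V n.+1 `|` closure (D n)) x.
    apply: closureS Dx => y Dy /=.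
    by have [?|?] := pselect (closure (D n) y); [right|left].
  rewrite closureU -((closure_id _).1 (@closed_closure _ (D n))).
  by move=> [|/IH//]; exists n.+1.
exists F, V; split => //.
- move=> x [[_ //]|->]; exact: subset_closure.
- by move=> x ?; left.
- case=> [//|i]; apply: openI; first by have [] := Dinv i.+1.
  by apply: closed_openC; exact: closed_closure.
- by case.
- by move=> i x /VD; have [_ DW _] := Dinv i; exact: DW.
- move=> i; apply/seteqP; split => // x [Vx Fx].
  by have [_ _ <-] := Dinv i; split => //; exact: closureS (VD i) _ Vx.
- move=> i j Vij; have [ij|ij|//] := ltngtP i j.
    by move: Vij; rewrite setIC (Vdisj _ _ ij) => -[].
  by move: Vij; rewrite (Vdisj _ _ ij) => -[].
- move=> x Wx; have [?|nFx] := pselect (F x); first by left.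
  right; have [k kP] := gF x nFx; apply: (Dcover k.+1).
  have := open_nbhs_nbhs (conj (@open_dist_gt _ F0 k.+1%:R^-1) kP).
  move=> nk B nB; have [z [Wz [Bz kz]]] := Wx _ (filterI nB nk).
  by exists z; split => //; exact: Dlayer.
- move=> k i ki; rewrite ((closure_id _).1 (@closed_dist_le _ F0 k.+1%:R^-1)).
  apply: closureS => x Vx /=; rewrite leNgt; apply/negP => kx.
  apply: (VnD i k.+1 ki x Vx); apply/subset_closure/Dlayer; split => //.
  by have [_ DW _] := Dinv i; exact/DW/VD.
Qed.

(** Branching is iterated, with nodes of length [n] using [K n] and [U n]. A point of [K n] is
    captured at level [n], and the child 0 of a suitable node at level [n] enters [U n]. *)
Lemma scheme_exists : [set: X] !=set0 -> sigma_compact X ->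
  exists W F : seq nat -> set X, scheme W F.
Proof.
move=> X0 scX; have [U [oU UP]] := sigma_compact_pi_base scX.
have [K cK KT] := scX; have hX := metric_hausdorff.
have /choice[b bP] (nW : nat * set X) : exists FV : set X * (nat -> set X),
    open nW.2 -> nW.2 !=set0 -> branching (K nW.1) (U nW.1) nW.2 FV.1 FV.2.
  case: nW => n W /=.
  have [[oW W0]|nW] := pselect (open W /\ W !=set0).
    have [F [V FV]] := branching_exists (cK n) (oU n) oW W0.
    by exists (F, V).
  by exists (set0, fun=> set0) => oW W0; case: nW.
pose fix W (s : seq nat) : set X :=
  if s is i :: t then (b (size t, W t)).2 i else setT.
pose F s := (b (size s, W s)).1.
have Winv s : open (W s) /\ W s !=set0.
  elim: s => [|i s [oW W0]]; first by split => //; exact: openT.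
  have br := bP (size s, W s) oW W0.
  by split; [exact: (branch_open br)|exact: (branch_child_neq0 br)].
have brP s : branching (K (size s)) (U (size s)) (W s) (F s) (fun i => W (i :: s)).
  by have [oW W0] := Winv s; exact: bP (size s, W s) oW W0.
have cF s : closed (F s) by apply: compact_closed => //; exact: branch_compact (brP s).
have F0 s := branch_neq0 (brP s).
have layer s (k i : nat) x : (k.+1 < i)%N -> k.+1%:R^-1 < dist (F s) x ->
    ~ closure (W (i :: s)) x.
  by move=> ki kx /(branch_layers (brP s) ki) /=; rewrite leNgt kx.
exists W, F; split.
- by [].
- by move=> s; have [] := Winv s.
- by move=> s; have [] := Winv s.
- by move=> s i; exact: branch_child (brP s) i.
- by move=> s i; exact: branch_child_piece (brP s) i.
- by move=> s i j; exact: branch_disjoint (brP s) i j.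
- exact: F0.
- by move=> s; exact: branch_piece (brP s).
- by move=> s x; exact: branch_cover (brP s) x.
- move=> s A cA AF0.
  have [k kP] := compact_dist_gt0 (branch_compact (brP s)) (F0 s) cA AF0.
  exists k.+2 => i ki; apply/seteqP; split => // x [/kP kx].
  exact: layer ki kx.
- move=> s x nFx; have [k] := ltr_add_invr (dist_gt0 (F0 s) (cF s) nFx).
  rewrite add0r => kP; exists [set y | k.+1%:R^-1 < dist (F s) y]; split => //.
  + exact: open_dist_gt.
  + apply/seteqP; split => // y [/= ky Fy]; move: ky.
    by rewrite (dist_eq0 (F0 s) Fy) ltNge invr_ge0 ler0n.
  + exists k.+2 => i ki; apply/seteqP; split => // y [ky].
    exact: layer ki ky.
- move=> x; have [n _ Knx] : (\bigcup_n K n) x by rewrite KT.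
  exists n => s sn Wx; apply: (branch_captures (brP s)).
  by rewrite sn.
- move=> O oO O0; have [n [Un0 UnO]] := UP O oO O0.
  (* The trace of [U n] on [W s] is not contained in the compact [F s], so [U n] meets a child of
     [s]. *)
  have reach m : exists s, size s = m /\ U n `&` W s !=set0; last first.
    have [s [sn UW]] := reach n.
    exists (0%N :: s); apply: subset_trans UnO; rewrite -sn.
    by apply: (branch_small (brP s)); rewrite sn.
  elim: m => [|m [s [sm UW]]]; first by exists [::]; rewrite setIT.
  have oUW : open (U n `&` W s) by apply: openI => //; have [] := Winv s.
  have [x [[Ux Wx] nFx]] :=
    nowhere_locally_compactD nlcX (branch_compact (brP s)) oUW UW.
  have [//|[i Wix]] := branch_cover (brP s) (subset_closure Wx).
  exists (i :: s); split; first by rewrite /= sm.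
  have [y [Wy Uy]] := Wix _ (open_nbhs_nbhs (conj (oU n) Ux)).
  by exists y; split.
Qed.

End Metric.

Lemma remote_points_homeo (R : realType) (X Y : topologicalType) :
  [set: X] !=set0 -> [set: Y] !=set0 -> sigma_compact X -> sigma_compact Y ->
  nowhere_locally_compact X -> nowhere_locally_compact Y ->
  metrizable R X -> metrizable R Y ->
  homeomorphic (set_type (remote_points R X)) (set_type (remote_points R Y)).
Proof.
move=> X0 Y0 scX scY nX nY [dX [X1 X2 X3 X4]] [dY [Y1 Y2 Y3 Y4]].
have [W [F schX]] := scheme_exists X1 X2 X3 X4 nX X0 scX.
have [V [G schY]] := scheme_exists Y1 Y2 Y3 Y4 nY Y0 scY.
have nd (Z : topologicalType) (z : Z) : hausdorff_space Z ->
    nowhere_locally_compact Z -> nowhere_dense [set z].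
  move=> hZ nZ; apply/closed_nowhere_dense.
    exact: (accessible_closed_set1 (hausdorff_accessible hZ)).
  by move=> U; apply: nowhere_locally_compactD => //; exact: compact_set1.
apply: (@remote_points_homeomorphic R X Y (piece_rel F G)).
- exact: piece_rel_irreducible schX schY.
- have [h1 h2 h3] := piece_rel_irreducible schY schX.
  have E : converse (piece_rel F G) = piece_rel G F.
    apply/funext => y; apply/funext => x; apply/propext.
    by split => -[s []]; exists s.
  by rewrite E; split.
- exact: metric_urysohn X1 X2 X3 X4.
- exact: metric_urysohn Y1 Y2 Y3 Y4.
- by move=> x; apply: nd => //; exact: metric_hausdorff X1 X2 X3 X4.
- by move=> y; apply: nd => //; exact: metric_hausdorff Y1 Y2 Y3 Y4.
Qed.

(** * The rational numbers *)

(** The exponent of 2 is even in the squared numerator but odd in twice the squared denominator. *)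
Lemma sqrt2_irrational (R : realType) (q : rat) : ratr q <> Num.sqrt 2 :> R.
Proof.
move=> qE; have q2 : q ^+ 2 = 2.
  apply: (fmorph_inj (ratr : {rmorphism rat -> R})).
  by rewrite rmorphXn /= qE sqr_sqrtr// ratr_nat.
have : (numq q ^+ 2)%:~R = (2 * denq q ^+ 2)%:~R :> rat.
  by rewrite intrM !rmorphXn /= numqE exprMn q2.
move=> /intr_inj/(congr1 absz); rewrite abszM !abszX => E.
have : odd (logn 2 (`|numq q| ^ 2)).
  rewrite E lognM ?expn_gt0 ?absz_gt0 ?denq_neq0// lognX /=.
  by rewrite mul2n odd_double.
by rewrite lognX mul2n odd_double.
Qed.

Lemma rationals_sigma_compact : sigma_compact rationals.
Proof.
exists (fun n => if unpickle n is Some q then [set (q : rationals)] else set0).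
  by move=> n; case: unpickle => [q|]; [exact: compact_set1|exact: compact0].
apply/seteqP; split => // q _; exists (pickle (q : rat)); first exact: I.
by rewrite pickleK.
Qed.

Lemma nbhs_rationals (x : rationals) (A : set rationals) :
  nbhs x A <-> exists2 e : rat, 0 < e & [set y : rat | `|(x : rat) - y| < e] `<=` A.
Proof. by rewrite -nbhs_ballE; split => -[e]; exists e. Qed.

Lemma rationals_metrizable (R : realType) : metrizable R rationals.
Proof.
exists (fun x y : rat => ratr `|x - y|); split.
- move=> x y; rewrite -(rmorph0 (ratr : {rmorphism rat -> R})); split.
    by move=> /fmorph_inj/eqP; rewrite normr_eq0 subr_eq0 => /eqP.
  by move=> ->; rewrite subrr normr0.
- by move=> x y; rewrite distrC.
- by move=> x y z; rewrite -rmorphD ler_rat ler_distD.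
- move=> x A; split.
    move=> /nbhs_rationals[e e0 eA]; exists (ratr e); first by rewrite ltr0q.
    by move=> y /=; rewrite ltr_rat; exact: eA.
  move=> [e e0 eA]; apply/nbhs_rationals.
  have [q] := rat_in_itvoo e0; rewrite in_itv/= => /andP[q0 qe].
  exists q; first by rewrite -(ltr0q R).
  by move=> y /= xy; apply: eA => /=; apply: lt_trans qe; rewrite ltr_rat.
Qed.

Lemma rationals_nowhere_locally_compact (R : realType) :
  nowhere_locally_compact rationals.
Proof.
move=> x [K /nbhs_rationals[e e0 eK] cK].
(* The rationals just above the irrational [a] have no rational cluster point. *)
pose a : R := ratr x + ratr e * (Num.sqrt 2 / 2).
have er0 : 0 < ratr e :> R by rewrite ltr0q.
have s0 : 0 < Num.sqrt 2 :> R by rewrite sqrtr_gt0.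
have s2 : Num.sqrt 2 < 2 :> R.
  have := @sqr_sqrtr R 2 (ler0n _ _); rewrite expr2; move: s0.
  by set s := Num.sqrt 2; nra.
have xa : ratr x < a by rewrite ltrDl mulr_gt0// divr_gt0.
have axe : a < ratr x + ratr e.
  by rewrite ltrD2l gtr_pMr// ltr_pdivrMr// mul1r.
have anq (q : rat) : ratr q != a.
  apply/eqP => qa; apply: (@sqrt2_irrational R ((q - x) / e * 2)).
  rewrite !rmorphM/= fmorphV rmorphB/= qa ratr_nat /a.
  by field; rewrite gt_eqF.
pose F := filter_from [set r : R | 0 < r]
  (fun r => [set q : rationals | a < ratr (q : rat) < a + r]).
have PF : ProperFilter F.
  apply: filter_from_proper => [|r /= r0]; last first.
    have [|q] := @rat_in_itvoo R a (a + r); first by rewrite ltrDl.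
    by rewrite in_itv/= => ?; exists q.
  apply: filter_from_filter; first by exists 1 => /=.
  move=> r t r0 t0; exists (Num.min r t); first by rewrite /= lt_min r0 t0.
  move=> q /= /andP[aq qm].
  by split; rewrite /= aq (lt_le_trans qm)// lerD2l ge_min lexx ?orbT.
have FK : F K.
  exists (ratr x + ratr e - a) => /=; first by rewrite subr_gt0.
  move=> q /= /andP[aq]; rewrite addrC subrK => qe; apply: eK => /=.
  have xq := lt_trans xa aq; rewrite ltr_rat in xq.
  rewrite -rmorphD ltr_rat in qe.
  by rewrite ltr0_norm ?subr_lt0// opprB ltrBlDl.
have [q [_ Fq]] := cK F PF FK.
(* Since [q] differs from [a], points within half their distance of [q] cannot lie within that half
   distance of [a]. *)
have h0 : 0 < `|ratr q - a| / 2 by rewrite divr_gt0// normr_gt0 subr_eq0.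
have [t] := rat_in_itvoo h0; rewrite in_itv/= => /andP[t0 th].
have nq : nbhs (q : rationals) [set y : rat | `|(q : rat) - y| < t].
  by apply/nbhs_rationals; exists t => //; rewrite -(ltr0q R).
have [|y [/= /andP[ay yh] qy]] := Fq [set y : rationals |
  a < ratr (y : rat) < a + `|ratr q - a| / 2] _ _ nq.
  by exists (`|ratr q - a| / 2).
have qy' : `|ratr q - ratr y| < `|ratr q - a| / 2 :> R.
  by apply: lt_trans th; rewrite -rmorphB -ratr_norm ltr_rat.
have := ler_distD (ratr y : R) (ratr q) a.
have : `|ratr y - a| < `|ratr q - a| / 2 :> R.
  by rewrite gtr0_norm ?subr_gt0// ltrBlDl.
move: qy'; set u := `|_ - a|; lra.
Qed.

Theorem corollary6p4 (R : realType) (X : topologicalType)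
    (X_nonempty : [set: X] !=set0)
    (X_sigma_compact : sigma_compact X)
    (X_nowhere_locally_compact : nowhere_locally_compact X)
    (X_metrizable : metrizable R X) :
  homeomorphic (set_type (remote_points R X)) (set_type (remote_points R rationals)).
Proof.
apply: remote_points_homeo => //.
- by exists (0 : rat).
- exact: rationals_sigma_compact.
- exact: (rationals_nowhere_locally_compact R).
- exact: rationals_metrizable.
Qed.
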